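(* Let $n\ge 6$ be an integer and let $p,q\ge 3$ be two integers satisfying $n=p+q$. For any spatial embedding $f$ of the complete graph $K_n$, we have $$\sum_{\lambda\in\Gamma_{p,q}(K_n)}\mathrm{lk}(f(\lambda))^2=\begin{cases}(n-6)!\displaystyle\sum_{\lambda\in\Gamma_{3,3}(K_n)}\mathrm{lk}(f(\lambda))^2 & (p=q),\\[2mm] 2\cdot (n-6)!\displaystyle\sum_{\lambda\in\Gamma_{3,3}(K_n)}\mathrm{lk}(f(\lambda))^2 & (p\neq q).\end{cases}$$ In particular, for any integer $n\ge 6$ and any spatial embedding $f$ of $K_n$, $$\sum_{p+q=n}\ \sum_{\lambda\in\Gamma_{p,q}(K_n)}\mathrm{lk}(f(\lambda))^2=(n-5)!\sum_{\lambda\in\Gamma_{3,3}(K_n)}\mathrm{lk}(f(\lambda))^2,$$ where the outer sum runs over all unordered pairs $\{p,q\}$ of integers $p,q\ge 3$ with $p+q=n$.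
   Context: We work in the piecewise linear category. $K_n$ is the complete graph on the $n$ vertices $1,\dots,n$. A spatial embedding of a finite graph $G$ is a (piecewise linear) embedding $f$ of $G$ into $\mathbb{R}^3$. A cycle of $G$ is a subgraph homeomorphic to a circle; a $p$-cycle is a cycle with exactly $p$ edges. $\Gamma_{p,q}(G)$ denotes the set of all unordered pairs $\lambda=\gamma\cup\gamma'$ of two (vertex-)disjoint cycles of $G$ consisting of a $p$-cycle and a $q$-cycle. For such $\lambda$, $f(\lambda)$ is a 2-component link and $\mathrm{lk}(f(\lambda))$ is its linking number; it is defined up to sign unless the components are oriented, so $\mathrm{lk}(f(\lambda))^2$ is well defined. *)

(* Defs.v *)
From mathcomp Require Import all_boot all_order all_algebra.
From mathcomp Require Import all_classical all_reals all_analysis.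
Import Order.TTheory GRing.Theory Num.Theory.
Import numFieldNormedType.Exports.

Set Implicit Arguments.
Unset Strict Implicit.
Unset Printing Implicit Defensive.

Local Open Scope ring_scope.

(** A finite simple graph is a symmetric irreflexive adjacency relation [e] on
    its vertex set ['I_n]; a subgraph without isolated vertices is the set of
    its edges, an edge being an unordered pair of vertices. *)

Definition complete_graph (n : nat) : rel 'I_n := [rel i j | i != j].

(** ** Cycles *)

(* An oriented cycle is given by its vertices in cyclic order; the bound on the
   size excludes the degenerate closed walks of length at most 2. *)
Definition oriented_cycle (n : nat) (e : rel 'I_n) (s : seq 'I_n) : bool :=
  (2 < size s)%N && ucycleb e s.

Definition cycle_edges (n : nat) (s : seq 'I_n) : {set {set 'I_n}} :=
  [set [set x; next s x]%SET | x in s]%SET.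

Definition cycles (n : nat) (e : rel 'I_n) (p : nat) : {set {set {set 'I_n}}} :=
  [set cycle_edges s | s : p.-tuple 'I_n & oriented_cycle e s]%SET.

(* [finset.cover c] is the set of vertices of the subgraph [c]. *)
Definition Gamma (n : nat) (e : rel 'I_n) (p q : nat) :
    {set {set {set {set 'I_n}}}} :=
  [set [set c; d]%SET | c in cycles e p, d in cycles e q
                      & [disjoint finset.cover c & finset.cover d]]%SET.

(** ** Piecewise linear spatial embeddings *)

Section Embeddings.
Variables (R : realType) (n : nat).

(* The point [(1 - t) i + t j] of the segment joining the vertices [i] and [j]
   of the standard simplex of [R^n]. *)
Definition edge_point (i j : 'I_n) (t : R) : 'rV[R]_n :=
  (1 - t) *: delta_mx 0 i + t *: delta_mx 0 j.

(* The underlying topological space of the graph, as a subcomplex of the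
   standard simplex; the case [i = j] accounts for isolated vertices. *)
Definition graph_realization (e : rel 'I_n) : set 'rV[R]_n :=
  [set x | exists i j t,
     [/\ (i == j) || e i j, 0 <= t <= 1 & x = edge_point i j t]]%classic.

Definition piecewise_linear01 (c : R -> 'rV[R]_3) : Prop :=
  exists2 s : seq R, itv_partition 0 1 s &
    forall k, (k < size s)%N -> exists a b : 'rV[R]_3,
      forall t, nth 0 (0 :: s) k <= t <= nth 0 s k -> c t = a + t *: b.

(* Only the values of [f] on the realization matter. As the pieces are closed,
   [f] is continuous on the realization, which is compact, so that injectivity
   makes it a topological embedding. *)
Definition spatial_embedding (e : rel 'I_n) (f : 'rV[R]_n -> 'rV[R]_3) : Prop :=
  {in graph_realization e &, injective f} /\
  (forall i j, e i j -> piecewise_linear01 (f \o edge_point i j)).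

(** ** Linking numbers *)

Definition triple_product (u v w : 'rV[R]_3) : R :=
  \det (col_mx u (col_mx v w) : 'M[R]_3).

Definition euclidean_norm (u : 'rV[R]_3) : R :=
  Num.sqrt (\sum_i u 0 i ^+ 2).

(* The Gauss linking integral of two curves parametrized by [0, 1]. A piecewise
   linear curve has a derivative except at finitely many parameters, where the
   value of [derive1] is irrelevant. *)
Definition gauss_integral (c d : R -> 'rV[R]_3) : R :=
  (4 * pi)^-1 *
  \int[lebesgue_measure]_(s in `[0, 1]%classic)
    \int[lebesgue_measure]_(t in `[0, 1]%classic)
      (triple_product (c s - d t) (derive1 c s) (derive1 d t)
         / euclidean_norm (c s - d t) ^+ 3).

(* The linking number of the images under [f] of two disjoint oriented cycles,
   by the Gauss integral: the line integral along a closed edge path is the sum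
   of the line integrals along its oriented edges. *)
Definition lk (f : 'rV[R]_n -> 'rV[R]_3) (r s : seq 'I_n) : R :=
  \sum_(x <- r) \sum_(y <- s)
    gauss_integral (f \o edge_point x (next r x)) (f \o edge_point y (next s y)).

(* [(r, s)] is an ordering and an orientation of the two components of [l]. *)
Definition link_orientation (e : rel 'I_n) (l : {set {set {set 'I_n}}})
    (rs : seq 'I_n * seq 'I_n) : Prop :=
  [/\ oriented_cycle e rs.1, oriented_cycle e rs.2 &
      l = [set cycle_edges rs.1; cycle_edges rs.2]%SET].

(* The square of the linking number of [f(l)], computed from an arbitrary choice
   of order and orientations of the components. *)
Definition lk_sq (e : rel 'I_n) (f : 'rV[R]_n -> 'rV[R]_3)
    (l : {set {set {set 'I_n}}}) : R :=
  let rs := xget ([::], [::]) [set rs | link_orientation e l rs]%classic in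
  lk f rs.1 rs.2 ^+ 2.

End Embeddings.

(* Main.v *)
Require Import Defs.
From mathcomp Require Import all_boot all_order all_algebra.
From mathcomp Require Import all_classical all_reals all_analysis.
From mathcomp Require Import measurable_realfun perm zify ring lra.
Import Order.TTheory GRing.Theory Num.Theory.
Import numFieldNormedType.Exports.
Local Open Scope ring_scope.

(** The linking number of two disjoint oriented cycles [r] and [s] is a double
    sum, over the edges of [r] and of [s], of a number [B x y z w] attached to
    the oriented edges [xy] and [zw]: the Gauss integral of the images of these
    edges. Two properties of [B] are enough for the theorem: it changes sign
    when an edge is reversed (substitution [t := 1 - t] in the integral), and
    it is symmetric in the two edges (Fubini; the integrand is bounded and
    measurable because the two images are piecewise linear and lie at a
    positive distance). Given these, the theorem is an identity between
    quadratic expressions in [B].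

    Fix disjoint lists [P] and [Q] of distinct vertices, and sum over all
    permutations [g] of the vertices the square of the linking number of the
    cycles [g P] and [g Q]. Expand the square along [P]. The product of two edges of [P]
    without common vertex contributes zero, because exchanging the end points
    of one of them is a symmetry of the sum that changes the sign of the
    product. There remain, for each edge of [P], its product with itself and
    with its two neighbours; summed over [g] these take two values [alpha] and
    [beta] that depend neither on the edge nor on the length of [P]. Hence the
    sum is [|P| (alpha + 2 beta)], a third of [|P|] times the same sum for a
    triangle (lemma [sum_sqr_cycle]). Doing the same along [Q] gives
    [9 perm_sum P Q = |P| |Q| perm_sum P3 Q3] for triangles [P3], [Q3] (lemma
    [perm_sum_triples]).

    It remains to count. A pair of lists of total length [p + q] without
    repetition is [(g P, g Q)] for [(n - p - q)!] permutations [g]; a [p]-cycle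
    is the cycle of [2 p] lists, its rotations and those of its reversal (lemma
    [cycle_edges_inj], which also makes the square of the linking number
    independent of the orientations); and an unordered pair of disjoint cycles
    comes from two ordered pairs of a [p]-cycle and a [q]-cycle if [p = q], and
    from one otherwise. For the second identity,
    [p + q = n] has [n - 5] ordered solutions with [p, q >= 3], and
    [(n - 5) (n - 6)! = (n - 5)!]. *)

Set Implicit Arguments.
Unset Strict Implicit.
Unset Printing Implicit Defensive.

(** * Bounded measurable functions *)

(** On a set of finite measure these two conditions give integrability, and they
    are stable under sums, products and finite unions of the domain. *)
Definition tame d (T : measurableType d) (R : realType) (D : set T)
    (F : T -> R) :=
  measurable_fun D F /\ exists M, forall z, D z -> `|F z| <= M.

Section Tame.
Variables (d : measure_display) (T : measurableType d) (R : realType).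
Implicit Types (D : set T) (F G : T -> R).

Lemma tame_cst D r : tame D (fun=> r : R).
Proof. by split; [exact: measurable_cst | exists `|r|]. Qed.

Lemma tameD D F G : tame D F -> tame D G -> tame D (fun z => F z + G z).
Proof.
move=> [mF [M FM]] [mG [N GN]]; split; first exact: measurable_funD.
exists (M + N) => z Dz; apply: le_trans (ler_normD _ _) _.
by rewrite lerD ?FM ?GN.
Qed.

Lemma tameM D F G : tame D F -> tame D G -> tame D (fun z => F z * G z).
Proof.
move=> [mF [M FM]] [mG [N GN]]; split; first exact: measurable_funM.
by exists (M * N) => z Dz; rewrite normrM ler_pM ?FM ?GN.
Qed.

Lemma tameN D F : tame D F -> tame D (fun z => - F z).
Proof.
move=> [mF [M FM]]; split; first exact: measurableT_comp.
by exists M => z Dz; rewrite normrN FM.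
Qed.

Lemma tameB D F G : tame D F -> tame D G -> tame D (fun z => F z - G z).
Proof. by move=> tF tG; apply: tameD => //; apply: tameN. Qed.

Lemma tame_sum D (I : finType) (F : I -> T -> R) :
  (forall i, tame D (F i)) -> tame D (fun z => \sum_i F i z).
Proof.
move=> tF; have -> : (fun z => \sum_i F i z) = \sum_i F i.
  by apply/funext => z; rewrite fct_sumE.
apply: big_ind => [|f g|i _]; [exact: tame_cst|exact: tameD|exact: tF].
Qed.

Lemma tame_integrable (mu : {measure set T -> \bar R}) D F :
  measurable D -> (mu D < +oo)%E -> tame D F -> mu.-integrable D (EFin \o F).
Proof.
move=> mD muD [mF [M FM]]; apply: measurable_bounded_integrable => //.
exists M; split; first by rewrite num_real.
by move=> x Mx z Dz; apply: le_trans (FM z Dz) (ltW Mx).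
Qed.

End Tame.

(** * Integrals over the unit interval *)

Section Fubini.
Variable R : realType.
Let mu := @lebesgue_measure R.
Let T := measurableTypeR R.
Let I : set T := `[0, 1]%classic.

Lemma measurable_unit : measurable I.
Proof. exact: measurable_itv. Qed.

Lemma lebesgue_unit : (mu I = 1)%E.
Proof. by rewrite /mu /I lebesgue_measure_itv /= lte_fin ltr01 oppr0 adde0. Qed.

Lemma tame_section (F : T * T -> R) s : I s -> tame (I `*` I) F ->
  tame I (fun t => F (s, t)).
Proof.
move=> Is [mF [M FM]]; split; last by exists M => t It; apply: FM.
apply: (@measurable_comp _ _ _ _ _ _ (I `*` I) F I (fun t => (s, t))) => //.
- by apply: measurableX; exact: measurable_unit.
- by move=> _ [t It <-].
- by apply: measurable_funTS; exact: pair1_measurable.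
Qed.

(** The inner integrals are real-valued truncations of extended ones; they are
    finite because [F] is bounded, so nothing is lost by the truncation. *)
Lemma Rintegral_Fubini_unit (F : T * T -> R) : tame (I `*` I) F ->
  \int[mu]_(s in I) (\int[mu]_(t in I) F (s, t)) =
  \int[mu]_(t in I) (\int[mu]_(s in I) F (s, t)).
Proof.
move=> tF.
have mI := measurable_unit.
have muI : (mu I < +oo)%E by rewrite lebesgue_unit ltry.
have mII : measurable (I `*` I) by apply: measurableX.
pose sw (z : T * T) := (z.2, z.1).
have tFs : tame (I `*` I) (F \o sw).
  case: tF => mF [M FM]; split; last by exists M => -[s t] [Is It]; apply: FM.
  apply: (@measurable_comp _ _ _ _ _ _ (I `*` I) F (I `*` I) sw) => //.
  - by move=> _ [[s t] [Is It] <-].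
  - by apply: measurable_funTS; apply: measurable_fun_pair;
      [exact: measurable_snd|exact: measurable_fst].
have iF : (mu \x mu)%E.-integrable setT ((EFin \o F) \_ (I `*` I)).
  apply/(integrable_mkcond (EFin \o F) mII); apply: tame_integrable => //.
  rewrite [X in (X < _)%E](product_measure1E _ _ mI mI).
  rewrite [X in (X * _)%E]lebesgue_unit [X in (_ * X)%E]lebesgue_unit.
  by rewrite mule1 ltry.
have E1 (G : T * T -> R) : tame (I `*` I) G ->
    (\int[mu]_x \int[mu]_y ((EFin \o G) \_ (I `*` I)) (x, y) =
     \int[mu]_(x in I) (\int[mu]_(y in I) G (x, y))%:E)%E.
  move=> tG; rewrite [RHS]integral_mkcond; apply: eq_integral => x _.
  rewrite patchE; case: ifPn => [|] xI.
    rewrite /Rintegral fineK; last first.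
      apply: integrable_fin_num => //.
      rewrite inE in xI; exact: (tame_integrable mI muI (tame_section xI tG)).
    rewrite [RHS]integral_mkcond; apply: eq_integral => y _.
    by rewrite !patchE in_setX xI.
  by apply: integral0_eq => y _; rewrite patchE in_setX (negbTE xI).
apply: (congr1 fine).
apply: etrans (esym (E1 F tF)) _; apply: etrans (Fubini iF) _.
apply: etrans _ (E1 (F \o sw) tFs).
by do 2!(apply: eq_integral => ? _); rewrite !patchE !in_setX andbC.
Qed.

(** The reflection [s |-> 1 - s] preserves both the interval and the Lebesgue
    measure, the latter because it preserves the length of intervals. *)
Lemma Rintegral_onem (g : T -> R) : tame I g ->
  \int[mu]_(s in I) g (1 - s) = \int[mu]_(s in I) g s.
Proof.
move=> [mg _]; rewrite /Rintegral; congr fine.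
have mI := measurable_unit.
pose h (x : measurableTypeR R) : measurableTypeR R := 1 - x.
have mh : measurable_fun setT h by apply: measurable_funB.
have hI : (h @^-1` I = I)%classic.
  by apply/seteqP; split => x; rewrite /I /h /= !in_itv /=; lra.
have muh A : measurable A -> mu A = pushforward mu h A.
  apply: lebesgue_measure_unique => //= _ [[a b]] _ <-.
  rewrite /pushforward.
  have -> : (h @^-1` `]a, b] = `[1 - b, 1 - a[)%classic.
    by apply/seteqP; split => x; rewrite /h /= !in_itv /=; lra.
  rewrite !lebesgue_measure_itv /= !lte_fin -!EFinB ltrD2l ltrN2.
  by case: ifP => // _; congr _%:E; ring.
have E (f : R -> \bar R) : measurable_fun I f -> (forall x, 0 <= f x)%E ->
    (\int[mu]_(x in I) f (1 - x)%R = \int[mu]_(x in I) f x)%E.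
  move=> mf f0.
  have := @ge0_integral_pushforward _ _ _ _ R h mh mu I f mI mf (fun y _ => f0 y).
  rewrite hI => <-; apply: eq_measure_integral => //= A mA _; exact/esym/muh.
have mG : measurable_fun I (EFin \o g) by apply/measurable_EFinP.
rewrite integralE [RHS]integralE; congr (_ - _)%E.
  apply: etrans (E _ (measurable_funepos mG) (funepos_ge0 _)).
  by apply: eq_integral => x _; rewrite !funeposE.
apply: etrans (E _ (measurable_funeneg mG) (funeneg_ge0 _)).
by apply: eq_integral => x _; rewrite !funenegE.
Qed.

End Fubini.

(** * Piecewise linear curves *)

Section PiecewiseLinear.
Variable R : realType.
Let T := measurableTypeR R.
Let I : set T := `[0, 1]%classic.

(** A property of sets stable under union passes from the pieces of a partition
    to the whole interval. *)
Lemma itv_partition_ind (P : set R -> Prop) (a b : R) (s : seq R) :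
  s != [::] -> itv_partition a b s ->
  (forall A B, P A -> P B -> P (A `|` B)%classic) ->
  (forall k, (k < size s)%N -> P `[nth 0 (a :: s) k, nth 0 s k]%classic) ->
  P `[a, b]%classic.
Proof.
move=> s0 abs PU.
elim: s a s0 abs => // x [|y s] IH a _ [] /= /andP[ax xs] /eqP lb Pk.
  by have := Pk 0%N isT; rewrite /= lb.
have Pax := Pk 0%N isT.
have Pxb : P `[x, b]%classic.
  by apply: IH => // [|k ks]; [split => //=; apply/eqP | apply: (Pk k.+1)].
have xb : x <= b.
  have ys : y :: s != [::] by [].
  have := @itv_partition_le _ _ x b (y :: s) _; apply; split => //=; exact/eqP.
suff -> : `[a, b]%classic = (`[a, x] `|` `[x, b])%classic by apply: PU.
apply/seteqP; split => t /=; rewrite !in_itv /=.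
  by move=> /andP[-> ->]; rewrite andbT; apply/orP; exact: le_total.
by case=> /andP[h1 h2]; apply/andP; split=> //;
  [exact: le_trans xb|exact: le_trans (ltW ax) _].
Qed.

Lemma piecewise_linear_ind (c : R -> 'rV[R]_3) (P : set R -> Prop) :
  piecewise_linear01 c ->
  (forall A B, P A -> P B -> P (A `|` B)%classic) ->
  (forall u v a b, u < v -> (forall t, u <= t <= v -> c t = a + t *: b) ->
     P `[u, v]%classic) ->
  P `[0, 1]%classic.
Proof.
move=> [s sp sc] PU Paff; apply: (itv_partition_ind _ sp) => // [|k ks].
  by apply/eqP => s0; move: sp; rewrite s0 => -[_ /=]; rewrite eq_sym oner_eq0.
have [a [b cab]] := sc k ks.
apply: (Paff _ _ a b) => //.
case: sp => sp _; exact: (pathP 0 sp).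
Qed.

Lemma tame_set1 (g : T -> R) t : tame [set t]%classic g.
Proof.
by split; [exact: measurable_fun_set1 | exists `|g t| => _ ->].
Qed.

Lemma tameU (A B : set T) (g : T -> R) :
  measurable A -> measurable B -> tame A g -> tame B g -> tame (A `|` B)%classic g.
Proof.
move=> mA mB [gA [M MA]] [gB [N NB]]; split; first exact/measurable_funU.
by exists (Num.max M N) => z [/MA|/NB] h; rewrite le_max h ?orbT.
Qed.

Lemma tame_eq (A : set T) (g h : T -> R) :
  {in A, g =1 h} -> tame A g -> tame A h.
Proof.
move=> gh [mg [M gM]]; split; first exact: eq_measurable_fun mg.
by exists M => z Az; rewrite -gh ?inE //; apply: gM.
Qed.

(** The open pieces suffice, since every function is bounded and measurable on
    the finitely many break points; this is what allows [g] to be a derivative. *)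
Lemma piecewise_linear_tame (c : R -> 'rV[R]_3) (g : T -> R) :
  piecewise_linear01 c ->
  (forall u v a b, u < v -> (forall t, u <= t <= v -> c t = a + t *: b) ->
     tame `]u, v[%classic g) ->
  tame I g.
Proof.
move=> pc gc.
suff [] : measurable (I : set T) /\ tame I g by [].
apply: (@piecewise_linear_ind c (fun A => measurable (A : set T) /\ tame A g)) => //.
  by move=> A B [mA tA] [mB tB]; split; [exact: measurableU|exact: tameU].
move=> u v a b uv cE; split; first exact: measurable_itv.
have -> : `[u, v]%classic = ([set u] `|` (`]u, v[ `|` [set v]))%classic.
  by rewrite setUitv1 // setU1itv // bnd_simp ltW.
have mo : measurable (`]u, v[%classic : set T) by exact: measurable_itv.
have m1 x : measurable ([set x]%classic : set T) by exact: measurable_set1.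
apply: tameU (m1 u) _ (tame_set1 _ _) _; first exact: measurableU.
by apply: tameU mo (m1 v) _ (tame_set1 _ _); exact: gc cE.
Qed.

Lemma tame_id (u v : R) : tame (`]u, v[%classic : set T) idfun.
Proof.
split; first exact: measurable_id.
exists (`|u| + `|v|) => t /=; rewrite in_itv /= => /andP[ut tv].
rewrite ler_norml; apply/andP; split.
  have := ler_norm (- u); rewrite normrN; have := normr_ge0 v; lra.
have := ler_norm v; have := normr_ge0 u; lra.
Qed.

Lemma tame_coord (c : R -> 'rV[R]_3) i :
  piecewise_linear01 c -> tame I (fun t => c t 0 i).
Proof.
move=> pc; apply: (piecewise_linear_tame pc) => u v a b uv cE.
apply: (@tame_eq _ (fun t => a 0 i + t * b 0 i)).
  move=> t /[!inE] /=; rewrite in_itv /= => /andP[ut tv].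
  by rewrite cE ?mxE // !ltW.
apply: tameD; first exact: tame_cst.
by apply: tameM; [exact: tame_id|exact: tame_cst].
Qed.

(** Near [t] the difference quotients are constant. *)
Lemma derive1_affine (c : R -> 'rV[R]_3) u v a b t :
  (forall t, u <= t <= v -> c t = a + t *: b) -> u < t < v ->
  derive1 c t = b.
Proof.
move=> cE /andP[ut tv].
rewrite /derive1; apply: cvg_lim => //.
apply: (@cvg_near_cst _ _ _ _ _).
have e0 : 0 < Num.min (t - u) (v - t) by rewrite lt_min !subr_gt0 ut tv.
near=> h.
have hN0 : h != 0 by near: h; exact: nbhs_dnbhs_neq.
have : `|h| < Num.min (t - u) (v - t) by near: h; apply: dnbhs0_lt.
rewrite lt_min !ltr_norml => /andP[/andP[h1 h2] /andP[h3 h4]].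
rewrite !cE; [|lra|lra].
rewrite opprD addrACA subrr add0r -scalerBl addrK scalerA mulVf //.
by rewrite scale1r.
Unshelve. all: by end_near.
Qed.

Lemma tame_derive1 (c : R -> 'rV[R]_3) i :
  piecewise_linear01 c -> tame I (fun t => derive1 c t 0 i).
Proof.
move=> pc; apply: (piecewise_linear_tame pc) => u v a b uv cE.
apply: (@tame_eq _ (fun t => b 0 i)); last exact: tame_cst.
by move=> t /[!inE] /=; rewrite in_itv /= => tuv; rewrite (derive1_affine cE).
Qed.

(** A continuous function without zeros on a compact rectangle is bounded away
    from zero. *)
Lemma affine_separated (a b a' b' : 'rV[R]_3) (u v u' v' : R) :
  u < v -> u' < v' ->
  (forall s t, u <= s <= v -> u' <= t <= v' -> a + s *: b != a' + t *: b') ->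
  exists2 e : R, 0 < e & forall s t, u <= s <= v -> u' <= t <= v' ->
    e <= \sum_i (a + s *: b - (a' + t *: b')) 0 i ^+ 2.
Proof.
move=> uv uv' sep.
pose f (z : R * R) := \sum_i (a 0 i + z.1 * b 0 i - (a' 0 i + z.2 * b' 0 i)) ^+ 2.
pose A := (`[u, v] `*` `[u', v'])%classic.
have fE s t : f (s, t) = \sum_i (a + s *: b - (a' + t *: b')) 0 i ^+ 2.
  by apply: eq_bigr => i _; rewrite !mxE.
have [||| [s t]] := @compact_EVT_min _ R f A.
- by exists (u, u'); split; rewrite /= in_itv /= lexx ltW.
- by apply: compact_setX; exact: segment_compact.
- apply: continuous_subspaceT; apply: continuous_big => [|i _ z].
    exact: add_continuous.
  apply: (cvgM _ _); apply: cvgB; apply: cvgD; (try exact: cvg_cst);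
    apply: cvgM; (try exact: cvg_cst); (exact: cvg_fst || exact: cvg_snd).
rewrite inE => -[/=]; rewrite !in_itv /= => us vt fmin.
exists (f (s, t)) => [|s' t' us' vt']; last first.
  by rewrite -fE; apply: fmin; rewrite inE; split; rewrite /= in_itv.
rewrite lt_neqAle eq_sym sumr_ge0 ?andbT => [|i _]; last exact: sqr_ge0.
apply: contra (sep s t us vt); rewrite fE psumr_eq0 => [|i _]; last exact: sqr_ge0.
move=> /allP z; rewrite -subr_eq0; apply/eqP/rowP => i.
by have := z i (mem_index_enum _); rewrite sqrf_eq0 => /eqP ->; rewrite !mxE.
Qed.

(** On a rectangle where both curves are affine this is [affine_separated], and
    the minimum over finitely many rectangles is again positive. *)
Lemma piecewise_linear_separated (c d : R -> 'rV[R]_3) :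
  piecewise_linear01 c -> piecewise_linear01 d ->
  (forall s t, 0 <= s <= 1 -> 0 <= t <= 1 -> c s != d t) ->
  exists2 e : R, 0 < e & forall s t, 0 <= s <= 1 -> 0 <= t <= 1 ->
    e <= \sum_i (c s - d t) 0 i ^+ 2.
Proof.
move=> pc pd sep.
(* Pieces are required to lie in the unit interval, since [sep] says nothing
   outside it. *)
pose P (A B : set R) := (A `<=` `[0, 1]%classic)%classic ->
  (B `<=` `[0, 1]%classic)%classic ->
  exists2 e : R, 0 < e & forall s t, A s -> B t -> e <= \sum_i (c s - d t) 0 i ^+ 2.
have sub (A B C : set R) : (A `|` B `<=` C)%classic -> (A `<=` C /\ B `<=` C)%classic.
  by move=> ABC; split => t At; apply: ABC; [left|right].
suff /(_ (@subset_refl _ _) (@subset_refl _ _))[e e0 he] :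
    P `[0, 1]%classic `[0, 1]%classic.
  by exists e => // s t s01 t01; apply: he; rewrite /= in_itv.
apply: (piecewise_linear_ind (P := fun A => P A `[0, 1]%classic) pc)
  => [A B PA PB /sub[sA sB] sI|u v a b uv cE].
  have [e e0 eA] := PA sA sI; have [e' e0' eB] := PB sB sI.
  exists (Num.min e e') => [|s t]; first by rewrite lt_min e0.
  by case=> h It; rewrite ge_min; [rewrite eA|rewrite eB ?orbT].
apply: (piecewise_linear_ind pd)
  => [A B PA PB sI /sub[sA sB]|u' v' a' b' uv' dE suv suv'].
  have [e e0 eA] := PA sI sA; have [e' e0' eB] := PB sI sB.
  exists (Num.min e e') => [|s t]; first by rewrite lt_min e0.
  by move=> Is; case=> h; rewrite ge_min; [rewrite eA|rewrite eB ?orbT].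
have [|e e0 he] := @affine_separated a b a' b' u v u' v' uv uv'.
  move=> s t us vt; rewrite -cE // -dE //; apply: sep.
    by have := suv s; rewrite /= !in_itv; apply.
  by have := suv' t; rewrite /= !in_itv; apply.
exists e => // s t; rewrite /= !in_itv /= => us vt.
by rewrite cE // dE //; apply: he.
Qed.

(** * The Gauss integral *)

Lemma triple_productE (u v w : 'rV[R]_3) :
  let i0 : 'I_3 := 0 in let i1 : 'I_3 := 1 in let i2 : 'I_3 := 2%:R in
  triple_product u v w =
    u 0 i0 * (v 0 i1 * w 0 i2 - v 0 i2 * w 0 i1) -
    u 0 i1 * (v 0 i0 * w 0 i2 - v 0 i2 * w 0 i0) +
    u 0 i2 * (v 0 i0 * w 0 i1 - v 0 i1 * w 0 i0).
Proof.
move=> i0 i1 i2; rewrite /triple_product.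
pose r (k : 'I_3) := if k == i0 then u else if k == i1 then v else w.
have E (k j : 'I_3) : (col_mx u (col_mx v w) : 'M[R]_3) k j = r k 0 j.
  have b0 : (k == i0) = (nat_of_ord k == 0)%N by [].
  have b1 : (k == i1) = (nat_of_ord k == 1)%N by [].
  rewrite /r b0 b1 mxE; case: splitP => [k' kE|k' kE]; rewrite kE.
    by rewrite !(ord1 k').
  by rewrite mxE; case: splitP => k'' kE'; rewrite kE' !(ord1 k'').
have -> (M : 'M[R]_3) : \det M = M i0 i0 * (M i1 i1 * M i2 i2 - M i1 i2 * M i2 i1)
    - M i0 i1 * (M i1 i0 * M i2 i2 - M i1 i2 * M i2 i0)
    + M i0 i2 * (M i1 i0 * M i2 i1 - M i1 i1 * M i2 i0).
  rewrite (expand_det_row _ i0) !big_ord_recl big_ord0 /cofactor.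
  rewrite !(expand_det_row _ (0 : 'I_2)) !big_ord_recl !big_ord0 /cofactor !det_mx11 !mxE.
  (* Indexing by natural numbers makes the indices produced by the expansion
     compute. *)
  pose N a b := M (inord a) (inord b).
  have MN x y : M x y = N x y by rewrite /N !inord_val.
  rewrite !MN /= /bump /= !add1n !addn0 /=; ring.
by rewrite !E.
Qed.

Definition disjoint_curves (c d : R -> 'rV[R]_3) : Prop :=
  forall s t, 0 <= s <= 1 -> 0 <= t <= 1 -> c s != d t.

Definition gauss_kernel (c d : R -> 'rV[R]_3) (z : T * T) : R :=
  triple_product (c z.1 - d z.2) (derive1 c z.1) (derive1 d z.2)
    / euclidean_norm (c z.1 - d z.2) ^+ 3.

Lemma tame_fst (g : T -> R) : tame I g -> tame (I `*` I)%classic (g \o fst).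
Proof.
move=> [mg [M gM]]; split; last by exists M => z [/gM].
have mI := @measurable_unit R.
apply: (@measurable_comp _ _ _ _ _ _ I) => //; first by move=> _ [z [? _] <-].
by apply: measurable_funTS; exact: measurable_fst.
Qed.

Lemma tame_snd (g : T -> R) : tame I g -> tame (I `*` I)%classic (g \o snd).
Proof.
move=> [mg [M gM]]; split; last by exists M => z [_ /gM].
have mI := @measurable_unit R.
apply: (@measurable_comp _ _ _ _ _ _ I) => //; first by move=> _ [z [_ ?] <-].
by apply: measurable_funTS; exact: measurable_snd.
Qed.

(** Lower bound on [g]: the function [x |-> x^(-3/2)] is unbounded near [0] and
    continuous only on the positive half-line. *)
Lemma tame_inv_norm3 (D : set (T * T)) (g : T * T -> R) (e : R) :
  0 < e -> (forall z, D z -> e <= g z) -> measurable D -> tame D g ->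
  tame D (fun z => (Num.sqrt (g z) ^+ 3)^-1).
Proof.
move=> e0 eg mD [mg _]; split.
  apply: (@measurable_comp _ _ _ _ _ _ (`]0, +oo[%classic : set T)
            (fun x : T => (Num.sqrt x ^+ 3)^-1 : T) D g) => //.
    by move=> _ [z Dz <-] /=; rewrite in_itv /= andbT (lt_le_trans e0) ?eg.
  apply: open_continuous_measurable_fun; first exact: interval_open.
  move=> x; rewrite inE /= in_itv /= andbT => x0.
  apply: cvgV; first by rewrite expf_neq0 // gt_eqF // sqrtr_gt0.
  apply: (@continuous_comp _ _ _ Num.sqrt (fun y => y ^+ 3) x).
    exact: sqrt_continuous.
  exact: exprn_continuous.
exists (Num.sqrt e ^+ 3)^-1 => z Dz.
have gz0 : 0 < g z by rewrite (lt_le_trans e0) ?eg.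
rewrite ger0_norm ?invr_ge0 ?exprn_ge0 ?sqrtr_ge0 //.
rewrite lef_pV2 ?posrE ?exprn_gt0 ?sqrtr_gt0 //.
by rewrite lerXn2r ?nnegrE ?sqrtr_ge0 // ler_wsqrtr ?eg.
Qed.

(** The kernel is a polynomial in the coordinates of the curves and of their
    derivatives, times a power of the distance, which stays away from zero. *)
Lemma gauss_kernel_tame (c d : R -> 'rV[R]_3) :
  piecewise_linear01 c -> piecewise_linear01 d -> disjoint_curves c d ->
  tame (I `*` I)%classic (gauss_kernel c d).
Proof.
move=> pc pd sep.
have [e e0 he] := piecewise_linear_separated pc pd sep.
have mII : measurable (I `*` I)%classic.
  by apply: measurableX; exact: measurable_unit.
have cP i := tame_fst (tame_coord i pc).
have dP i := tame_snd (tame_coord i pd).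
have c'P i := tame_fst (tame_derive1 i pc).
have d'P i := tame_snd (tame_derive1 i pd).
have cdP i : tame (I `*` I)%classic (fun z => (c z.1 - d z.2) 0 i).
  rewrite (_ : (fun z => _) = fun z => c z.1 0 i - d z.2 0 i); last first.
    by apply/funext => z; rewrite !mxE.
  exact: tameB (cP i) (dP i).
rewrite /gauss_kernel; apply: tameM.
  under eq_fun do rewrite triple_productE.
  by apply: tameD; [apply: tameB|]; apply: tameM (cdP _) _;
    apply: tameB; apply: tameM (c'P _) (d'P _).
apply: (tame_inv_norm3 e0) => // [z|].
  by rewrite /I => -[/=]; rewrite !in_itv /=; exact: he.
by apply: tame_sum => i; apply: tameM.
Qed.

(** The identity also holds where the derivative does not exist: both sides are
    then the default value of a limit, which is zero. *)
Lemma derive1_onem (c : R -> 'rV[R]_3) t :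
  derive1 (fun s => c (1 - s)) t = - derive1 c (1 - t).
Proof.
rewrite /derive1.
set g := (fun h => h^-1 *: (c (h + (1 - t)) - c (1 - t))).
have E : (fun h => h^-1 *: (c (1 - (h + t)) - c (1 - t))) = (- g) \o -%R.
  apply/funext => h.
  change (h^-1 *: (c (1 - (h + t)) - c (1 - t)) =
    - ((- h)^-1 *: (c (- h + (1 - t)) - c (1 - t)))).
  rewrite invrN scaleNr opprK; have -> // : 1 - (h + t) = - h + (1 - t) by ring.
have F0 (B : set R) : (0 : R)^'%classic B -> (0 : R)^'%classic (-%R @^-1` B)%classic.
  move=> FB; rewrite -[X in X^'%classic]oppr0 dnbhsN; exists B => //.
  apply/seteqP; split => [_ [x Bx <-] /=|x Bx]; first by rewrite opprK.
  by exists (- x); rewrite ?opprK.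
(* The punctured neighbourhoods of zero are symmetric. *)
have FN : (((- g) \o -%R) @ 0^')%classic = ((- g) @ 0^')%classic.
  apply/seteqP; split => A; last exact: F0.
  move=> /F0; congr (0^'%classic _); apply/seteqP.
  by split => x /=; rewrite opprK.
rewrite E FN.
have [cg|ncg] := pselect (cvg (g @ 0^')%classic); first exact: limN.
rewrite (dvgP ncg) dvgP; last by rewrite is_cvgNE.
by apply/matrixP => i j; rewrite !mxE oppr0.
Qed.

Lemma triple_productN (u v w : 'rV[R]_3) :
  triple_product u v (- w) = - triple_product u v w.
Proof. by rewrite !triple_productE !mxE; ring. Qed.

Lemma triple_product_swap (u v w : 'rV[R]_3) :
  triple_product (- u) w v = triple_product u v w.
Proof. by rewrite !triple_productE !mxE; ring. Qed.

Lemma euclidean_normN (u : 'rV[R]_3) : euclidean_norm (- u) = euclidean_norm u.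
Proof.
by congr Num.sqrt; apply: eq_bigr => i _; rewrite mxE sqrrN.
Qed.

Lemma gauss_kernelC c d s t : gauss_kernel c d (s, t) = gauss_kernel d c (t, s).
Proof.
by rewrite /gauss_kernel /= -(opprB (d t)) triple_product_swap euclidean_normN.
Qed.

Lemma gauss_integralE c d : gauss_integral c d = (4 * pi)^-1 *
  \int[@lebesgue_measure R]_(s in I)
    \int[@lebesgue_measure R]_(t in I) gauss_kernel c d (s, t).
Proof. by []. Qed.

Lemma gauss_integralC (c d : R -> 'rV[R]_3) :
  piecewise_linear01 c -> piecewise_linear01 d -> disjoint_curves c d ->
  gauss_integral c d = gauss_integral d c.
Proof.
move=> pc pd sep; rewrite !gauss_integralE; apply: (congr1 (fun x => _ * x)).
apply: etrans (Rintegral_Fubini_unit (gauss_kernel_tame pc pd sep)) _.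
by apply: eq_Rintegral => t _; apply: eq_Rintegral => s _; apply: gauss_kernelC.
Qed.

(** Also true for infinite values: [+oo - +oo] is an infinity, and the real part
    of an infinity is zero. *)
Lemma fineB_antisym (a b : \bar R) : fine (a - b)%E = - fine (b - a)%E.
Proof. by case: a b => [x| |] [y| |] //=; rewrite ?oppr0 // opprB. Qed.

(** The identity survives divergent integrals by [fineB_antisym]. *)
Lemma RintegralN (D : set T) (g : T -> R) :
  \int[@lebesgue_measure R]_(x in D) (- g x) =
  - \int[@lebesgue_measure R]_(x in D) g x.
Proof.
rewrite /Rintegral integralE [in RHS]integralE.
have -> : ((fun x : T => (- g x)%:E)^\+ = (fun x => (g x)%:E)^\-)%E.
  by apply/funext => x; rewrite funeposE funenegE.
have -> : ((fun x : T => (- g x)%:E)^\- = (fun x => (g x)%:E)^\+)%E.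
  by apply/funext => x; rewrite funeposE funenegE EFinN oppeK.
exact: fineB_antisym.
Qed.

(** Only the second curve is reversed, so that the substitution takes place in
    the inner integral; reversing the first one follows by symmetry. *)
Lemma gauss_integral_onem (c d : R -> 'rV[R]_3) :
  piecewise_linear01 c -> piecewise_linear01 d -> disjoint_curves c d ->
  gauss_integral c (fun t => d (1 - t)) = - gauss_integral c d.
Proof.
move=> pc pd sep; rewrite !gauss_integralE -mulrN -RintegralN.
apply: (congr1 (fun x => _ * x)).
apply: eq_Rintegral => s Is; rewrite inE in Is.
have tK := tame_section Is (gauss_kernel_tame pc pd sep).
rewrite -(Rintegral_onem tK) -RintegralN; apply: eq_Rintegral => t _.
by rewrite /gauss_kernel /= derive1_onem triple_productN mulNr.
Qed.

End PiecewiseLinear.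

(** * Cycles and their edge sets *)

Section CycleEdges.
Variable n : nat.
Implicit Types s t : seq 'I_n.

Lemma next_neq s x : uniq s -> (1 < size s)%N -> x \in s -> next s x != x.
Proof.
move=> us s1 xs; have [i s' sE] := rot_to xs.
rewrite -(next_rot i us) sE; move: us s1; rewrite -(rot_uniq i) -(size_rot i) sE.
case: s' {sE} => [|y s'] //= /andP[+ _] _; rewrite eqxx inE negb_or eq_sym.
by case/andP.
Qed.

(** If they were equal, the cycle would close up after two steps. *)
Lemma prev_neq_next s x : uniq s -> (2 < size s)%N -> x \in s -> prev s x != next s x.
Proof.
move=> us s2 xs; apply/eqP => pn.
have := next_prev us x; rewrite pn.
have [i s' sE] := rot_to xs.
rewrite -!(next_rot i us) sE; move: us s2.
rewrite -(rot_uniq i) -(size_rot i) sE.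
case: s' {sE} => [|y [|z s']] //= /andP[+ _] _.
rewrite !inE !negb_or eqxx => /and3P[/negPf xy xz _].
by rewrite eq_sym xy eqxx => zx; rewrite zx eqxx in xz.
Qed.

Lemma set2_inj (T : finType) (a b c d : T) :
  [set a; b]%SET = [set c; d]%SET -> (a = c /\ b = d) \/ (a = d /\ b = c).
Proof.
move=> e.
have : a \in [set c; d]%SET by rewrite -e !inE eqxx.
have : b \in [set c; d]%SET by rewrite -e !inE eqxx orbT.
have : c \in [set a; b]%SET by rewrite e !inE eqxx.
have : d \in [set a; b]%SET by rewrite e !inE eqxx orbT.
by rewrite !inE => /pred2P[->|->] /pred2P[->|->] /pred2P[|] ? /pred2P[|] ?; subst; auto.
Qed.

Lemma mem_cycle_edges s x y : uniq s -> x \in s ->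
  ([set x; y]%SET \in cycle_edges s) = (y == next s x) || (y == prev s x).
Proof.
move=> us xs; apply/imsetP/orP => [[z zs /set2_inj[[-> ->]|[-> ->]]]|].
- by left.
- by right; rewrite prev_next.
- case=> /eqP ->; first by exists x.
  by exists (prev s x); rewrite ?mem_prev // next_prev // finset.setUC.
Qed.

Lemma cycle_edges_rot s i : uniq s -> cycle_edges (rot i s) = cycle_edges s.
Proof.
move=> us; apply/setP => e; apply/imsetP/imsetP => -[x xs ->]; exists x;
  by rewrite ?next_rot ?mem_rot // -(mem_rot i).
Qed.

Lemma cycle_edges_rev s : uniq s -> cycle_edges (rev s) = cycle_edges s.
Proof.
move=> us; apply/setP => e; apply/imsetP/imsetP => -[x]; rewrite ?mem_rev => xs ->.
  by exists (prev s x); rewrite ?mem_prev // next_prev // next_rev // finset.setUC.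
by exists (next s x); rewrite ?mem_rev ?mem_next // next_rev // prev_next // finset.setUC.
Qed.

Lemma cover_cycle_edges s : uniq s ->
  finset.cover (cycle_edges s) = [set x in s]%SET.
Proof.
move=> us; apply/setP => x; rewrite inE; apply/bigcupP/idP => [[e /imsetP[y ys ->]]|xs].
  by rewrite !inE => /pred2P[->|->] //; rewrite mem_next.
by exists [set x; next s x]%SET; [apply: imset_f|rewrite !inE eqxx].
Qed.

Lemma cycle_edges_mem s t : uniq s -> uniq t -> cycle_edges s = cycle_edges t ->
  s =i t.
Proof.
move=> us ut e x; have := congr1 (fun c => x \in finset.cover c) e.
by rewrite !cover_cycle_edges // !inE.
Qed.

Lemma rot_index_traject s x : uniq s -> x \in s ->
  rot (index x s) s = traject (next s) x (size s).
Proof.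
move=> us xs; have := cycle_next us.
rewrite -(rot_cycle (index x s)) -(size_rot (index x s)).
rewrite /rot (drop_nth x) ?index_mem // nth_index // cat_cons.
move: (_ ++ _) => q; rewrite [cycle _ _]/= rcons_path => /andP[/fpathE -> _] /=.
by rewrite size_traject.
Qed.

(** At [next s x] both cycles have the same two neighbours, one of which is [x]
    in both cases; so the other one, the successor, is also the same. *)
Lemma next_propagate s t x : uniq s -> uniq t -> (2 < size s)%N ->
  cycle_edges s = cycle_edges t -> x \in s -> next s x = next t x ->
  next s (next s x) = next t (next s x).
Proof.
move=> us ut s2 e xs nst; set y := next s x.
have st := cycle_edges_mem us ut e.
have ys : y \in s by rewrite mem_next.
have : [set y; next s y]%SET \in cycle_edges t.
  by rewrite -e mem_cycle_edges // eqxx.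
rewrite mem_cycle_edges -?st // => /orP[/eqP //|].
rewrite {2}/y nst prev_next // => /eqP nyx.
by have := prev_neq_next us s2 ys; rewrite nyx /y prev_next // eqxx.
Qed.

Lemma cycle_edges_next s t x : uniq s -> uniq t -> (2 < size s)%N ->
  cycle_edges s = cycle_edges t -> x \in s -> next s x = next t x ->
  rot (index x s) s = rot (index x t) t.
Proof.
move=> us ut s2 e xs nst; have st := cycle_edges_mem us ut e.
rewrite !rot_index_traject -?st //.
have -> : size t = size s by apply/perm_size/uniq_perm => // y; rewrite st.
apply: (@eq_from_nth _ x); rewrite !size_traject // => i ilt.
rewrite !nth_traject //.
suff [-> //] : iter i (next s) x = iter i (next t) x /\
  (iter i (next s) x \in s /\ next s (iter i (next s) x) = next t (iter i (next s) x)).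
elim: i {ilt} => [|i [IH1 [IH2 IH3]]] //=.
by rewrite -IH1 -IH3 mem_next; do 2!split => //; apply: next_propagate.
Qed.

(** The edges at a vertex [x] of [s] lead to [next s x] and [prev s x]. So the
    successor of [x] in [t] is one of these, and it determines [t] by
    [next_propagate]: [t] runs through the cycle as [s] does or backwards. *)
Lemma cycle_edges_inj s t : uniq s -> uniq t -> (2 < size s)%N ->
  cycle_edges s = cycle_edges t ->
  exists2 i, (i < size s)%N & t = rot i s \/ t = rot i (rev s).
Proof.
move=> us ut s2 e; have st := cycle_edges_mem us ut e.
case: t => [|x t] in ut e st *.
  by case: s {us e} s2 st => // y s _ /(_ y); rewrite inE eqxx.
have xt : x \in x :: t by rewrite inE eqxx.
have xs : x \in s by rewrite st.
have t0 : rot (index x (x :: t)) (x :: t) = x :: t by rewrite /= eqxx rot0.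
have : [set x; next (x :: t) x]%SET \in cycle_edges s.
  by rewrite e mem_cycle_edges // eqxx.
rewrite mem_cycle_edges // => /orP[] /eqP nE.
  exists (index x s); first by rewrite index_mem.
  by left; rewrite (@cycle_edges_next _ (x :: t)).
exists (index x (rev s)); first by rewrite -size_rev index_mem mem_rev.
right; rewrite (@cycle_edges_next _ (x :: t)) ?rev_uniq ?size_rev ?mem_rev //.
  by rewrite cycle_edges_rev.
by rewrite next_rev.
Qed.

End CycleEdges.

(** * Averaging over the permutations of the vertices *)

Section HamiltonianSum.
Variables (R : numDomainType) (n : nat).
Implicit Types (a b c u v x y z : 'I_n).

(** In the application [h s a b] sums [B (s a) (s b) _ _] over the edges of a
    cycle disjoint from [P], which the transpositions of [P] do not move. *)
Section Averaging.
Variables (h : {perm 'I_n} -> 'I_n -> 'I_n -> R) (P : seq 'I_n).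
Hypothesis hN : forall s a b, h s b a = - h s a b.
Hypothesis hP : forall u v s a b, u \in P -> v \in P ->
  h (tperm u v * s)%g a b = h s (tperm u v a) (tperm u v b).

Definition pairing a b a' b' : R := \sum_s h s a b * h s a' b'.

Lemma pairing_tperm u v a b a' b' : u \in P -> v \in P ->
  pairing (tperm u v a) (tperm u v b) (tperm u v a') (tperm u v b') =
  pairing a b a' b'.
Proof.
move=> uP vP; rewrite /pairing.
rewrite [RHS](reindex_inj (mulgI (tperm u v))) /=.
by apply: eq_bigr => s _; rewrite !hP.
Qed.

(** Exchanging [a] and [b] preserves the sum and changes the sign of its first
    factor. *)
Lemma pairing_disjoint a b a' b' : a \in P -> b \in P ->
  uniq [:: a; b; a'; b'] -> pairing a b a' b' = 0.
Proof.
move=> aP bP /=; rewrite !inE !negb_or -!andbA.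
move=> /and5P[ab aa' ab' ba' /andP[bb' _]].
have := pairing_tperm a b a' b' aP bP.
rewrite tpermL tpermR !tpermD // => e.
have : pairing b a a' b' = - pairing a b a' b'.
  by rewrite /pairing -sumrN; apply: eq_bigr => s _; rewrite hN mulNr.
rewrite e => /eqP; rewrite -addr_eq0 -mulr2n mulrn_eq0 /=.
by move/eqP.
Qed.

(** Three transpositions carry any triple of distinct elements to any other. *)
Lemma tperm_invariant_triple (F : 'I_n -> 'I_n -> 'I_n -> R) :
  (forall u v a b c, u \in P -> v \in P ->
     F (tperm u v a) (tperm u v b) (tperm u v c) = F a b c) ->
  forall a b c x y z, {subset [:: a; b; c] <= P} -> {subset [:: x; y; z] <= P} ->
    uniq [:: a; b; c] -> uniq [:: x; y; z] -> F a b c = F x y z.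
Proof.
move=> FP a b c x y z abcP xyzP uabc uxyz.
have tP u v w : u \in P -> v \in P -> w \in P -> tperm u v w \in P.
  by move=> uP vP wP; case: tpermP.
have [aP bP cP] : [/\ a \in P, b \in P & c \in P].
  by split; apply: abcP; rewrite !inE eqxx ?orbT.
have [xP yP zP] : [/\ x \in P, y \in P & z \in P].
  by split; apply: xyzP; rewrite !inE eqxx ?orbT.
move: uabc uxyz; rewrite /= !inE !negb_or !andbT.
move=> /andP[/andP[ab ac] bc] /andP[/andP[xy xz] yz].
rewrite -(FP a x) // tpermL.
set b1 := tperm a x b; set c1 := tperm a x c.
have b1x : x != b1 by rewrite /b1 -{1}(tpermL a x) (inj_eq perm_inj).
have c1x : x != c1 by rewrite /c1 -{1}(tpermL a x) (inj_eq perm_inj).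
have bc1 : b1 != c1 by rewrite (inj_eq perm_inj).
rewrite -(FP b1 y) ?tP // tpermL tpermD; [|by rewrite eq_sym|by rewrite eq_sym].
set c2 := tperm b1 y c1.
have c2x : x != c2.
  rewrite /c2 -{1}(@tpermD _ b1 y x) ?(inj_eq perm_inj) // eq_sym //.
have c2y : y != c2 by rewrite /c2 -{1}(tpermL b1 y) (inj_eq perm_inj).
by rewrite -(FP c2 z) ?tP // tpermL !tpermD // eq_sym.
Qed.

(** The expansion of the square described at the top: an edge of the cycle
    pairs nontrivially with itself and with its two neighbours only, and the
    values do not depend on the edge. *)
Lemma sum_sqr_cycle a b c : uniq P -> (2 < size P)%N ->
  {subset [:: a; b; c] <= P} -> uniq [:: a; b; c] ->
  \sum_s (\sum_(x <- P) h s x (next P x)) ^+ 2 =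
  (pairing a b a b + pairing a b b c *+ 2) *+ size P.
Proof.
move=> uP P2 abcP uabc.
have -> : \sum_s (\sum_(x <- P) h s x (next P x)) ^+ 2 =
    \sum_(x <- P) \sum_(y <- P) pairing x (next P x) y (next P y).
  under eq_bigr => s _.
    rewrite expr2 mulr_suml.
    under eq_bigr do rewrite mulr_sumr.
    over.
  rewrite exchange_big /=; apply: eq_bigr => x _.
  by rewrite exchange_big /=; apply: eq_bigr => y _.
rewrite [LHS](eq_big_seq (fun=> pairing a b a b + pairing a b b c *+ 2)).
  by rewrite big_const_seq count_predT iter_addr_0.
move=> x xP; set y := next P x; set z := prev P x.
have yP : y \in P by rewrite mem_next.
have zP : z \in P by rewrite mem_prev.
have P1 : (1 < size P)%N by apply: ltnW.
have nN t : t \in P -> next P t != t by move=> tP; apply: next_neq.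
have yx : y != x by apply: nN.
have zx : z != x by rewrite -(inj_eq (can_inj (prev_next uP))) next_prev // eq_sym nN.
have zy : z != y by apply: prev_neq_next.
rewrite big_uniq //= (bigD1 x) //= (bigD1 y) /=; last by rewrite yP yx.
rewrite (bigD1 z) /=; last by rewrite zP zx zy.
rewrite big1 ?addr0 => [|t /andP[/andP[/andP[tP tx] ty] tz]]; last first.
  apply: pairing_disjoint => //=; rewrite !inE !negb_or -!andbA.
  have tn : t != next P t by rewrite eq_sym nN.
  have xn : x != next P t.
    by rewrite -[x](next_prev uP) -/z (inj_eq (can_inj (prev_next uP))) eq_sym.
  have yn : y != next P t by rewrite (inj_eq (can_inj (prev_next uP))) eq_sym.
  by rewrite xn yn tn (eq_sym x y) (eq_sym x t) (eq_sym y t) yx tx ty.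
rewrite -/y next_prev //.
have yN : y != next P y by rewrite eq_sym nN.
have xN : x != next P y.
  by rewrite -[x](next_prev uP) -/z (inj_eq (can_inj (prev_next uP))).
have sub u v w : u \in P -> v \in P -> w \in P -> {subset [:: u; v; w] <= P}.
  by move=> uP' vP wP t; rewrite !inE => /or3P[] /eqP ->.
rewrite mulr2n; congr (_ + (_ + _)).
- apply: (@tperm_invariant_triple (fun a b _ => pairing a b a b) _ x y z a b c) => //.
  + by move=> *; rewrite pairing_tperm.
  + exact: sub.
  + by rewrite /= !inE negb_or (eq_sym x y) (eq_sym x z) (eq_sym y z) yx zx zy.
- apply: (@tperm_invariant_triple (fun a b c => pairing a b b c)
    _ x y (next P y) a b c) => //.
  + by move=> *; rewrite pairing_tperm.
  + by apply: sub; rewrite // mem_next.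
  + by rewrite /= !inE negb_or (eq_sym x y) yx xN yN.
(* The preceding edge: as a pairing of consecutive edges it starts at [z]. *)
- have -> : pairing x y z x = pairing z x x y.
    by apply: eq_bigr => s _; rewrite mulrC.
  apply: (@tperm_invariant_triple (fun a b c => pairing a b b c) _ z x y a b c) => //.
  + by move=> *; rewrite pairing_tperm.
  + exact: sub.
  + by rewrite /= !inE negb_or (eq_sym x y) yx zx zy.
Qed.

End Averaging.

Section Bilinear.
Variable B : 'I_n -> 'I_n -> 'I_n -> 'I_n -> R.
Hypothesis BN : forall a b c d, B b a c d = - B a b c d.
Hypothesis BC : forall a b c d, B c d a b = B a b c d.

(** The linking number, when [B] is given by Gauss integrals. *)
Definition cycle_form (r s : seq 'I_n) : R :=
  \sum_(x <- r) \sum_(y <- s) B x (next r x) y (next s y).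

Lemma cycle_formC r s : cycle_form s r = cycle_form r s.
Proof.
rewrite /cycle_form exchange_big; apply: eq_bigr => x _.
by apply: eq_bigr => y _; rewrite BC.
Qed.

Lemma cycle_form_rot i r s : uniq r -> cycle_form (rot i r) s = cycle_form r s.
Proof.
move=> ur; rewrite /cycle_form (perm_big r) ?perm_rot //=.
by under eq_bigr do rewrite next_rot //.
Qed.

(** The edge leaving [x] in the reversed cycle is the edge of [r] that enters
    [x], reversed. *)
Lemma cycle_form_rev r s : uniq r -> cycle_form (rev r) s = - cycle_form r s.
Proof.
move=> ur; rewrite /cycle_form (perm_big r) ?perm_rev //=.
rewrite !big_uniq //= (reindex_onto (next r) (prev r)) /=; last first.
  by move=> x _; exact: next_prev.
rewrite -sumrN; apply: eq_big => [x|x xr].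
  by rewrite mem_next prev_next // eqxx andbT.
rewrite next_rev // prev_next // -sumrN; apply: eq_bigr => y _; exact: BN.
Qed.

Lemma cycle_form_sqr_edgesl r r' s : uniq r -> uniq r' -> (2 < size r)%N ->
  cycle_edges r = cycle_edges r' -> cycle_form r' s ^+ 2 = cycle_form r s ^+ 2.
Proof.
move=> ur ur' r2 e; have [i _ [->|->]] := cycle_edges_inj ur ur' r2 e.
  by rewrite cycle_form_rot.
by rewrite cycle_form_rot ?rev_uniq // cycle_form_rev // sqrrN.
Qed.

Lemma cycle_form_sqr_edges r s r' s' : uniq r -> uniq s -> uniq r' -> uniq s' ->
  (2 < size r)%N -> (2 < size s)%N ->
  [set cycle_edges r; cycle_edges s]%SET = [set cycle_edges r'; cycle_edges s']%SET ->
  cycle_form r' s' ^+ 2 = cycle_form r s ^+ 2.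
Proof.
move=> ur us ur' us' r2 s2 /set2_inj[[er es]|[er es]].
  rewrite (cycle_form_sqr_edgesl _ ur ur') // -!(cycle_formC r).
  exact: cycle_form_sqr_edgesl.
rewrite (cycle_form_sqr_edgesl _ us ur') // -!(cycle_formC s).
by rewrite (cycle_form_sqr_edgesl _ ur us') // cycle_formC.
Qed.

Definition perm_sum (P Q : seq 'I_n) : R :=
  \sum_(g : {perm 'I_n}) cycle_form (map g P) (map g Q) ^+ 2.

Lemma perm_sumC P Q : perm_sum Q P = perm_sum P Q.
Proof. by apply: eq_bigr => g _; rewrite cycle_formC. Qed.

(** Both sides are multiples of the same [alpha + 2 beta], by [sum_sqr_cycle]
    for [P] and for the triangle. A permutation of [P] fixes [Q], which makes
    the partial sums over [Q] satisfy the invariance that lemma asks for. *)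
Lemma perm_sum_triple P Q a b c : uniq (P ++ Q) -> (2 < size P)%N ->
  {subset [:: a; b; c] <= P} -> uniq [:: a; b; c] ->
  perm_sum P Q *+ 3 = perm_sum [:: a; b; c] Q *+ size P.
Proof.
move=> uPQ P2 abcP uabc.
have [uP dPQ uQ] : [/\ uniq P, ~~ has [in P] Q & uniq Q].
  by move: uPQ; rewrite cat_uniq => /and3P[].
pose h (g : {perm 'I_n}) x y := \sum_(z <- Q) B (g x) (g y) (g z) (g (next Q z)).
have hN g x y : h g y x = - h g x y.
  by rewrite -sumrN; apply: eq_bigr => z _; exact: BN.
have hP u v g x y : u \in P -> v \in P ->
    h (tperm u v * g)%g x y = h g (tperm u v x) (tperm u v y).
  move=> uP' vP; apply: eq_big_seq => z zQ.
  have fix_Q w : w \in Q -> tperm u v w = w.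
    by move=> wQ; rewrite tpermD //; apply/eqP => e; case/negP: dPQ;
      apply/hasP; exists w; rewrite //= -e.
  by rewrite !permM (fix_Q z) // (fix_Q (next Q z)) ?mem_next.
have E P' : uniq P' -> perm_sum P' Q = \sum_g (\sum_(x <- P') h g x (next P' x)) ^+ 2.
  move=> uP'; apply: eq_bigr => g _; congr (_ ^+ 2).
  rewrite /cycle_form big_map; apply: eq_bigr => x _; rewrite big_map.
  by apply: eq_bigr => y _; rewrite !next_map //; exact: perm_inj.
have hP' u v g x y : u \in [:: a; b; c] -> v \in [:: a; b; c] ->
    h (tperm u v * g)%g x y = h g (tperm u v x) (tperm u v y).
  by move=> /abcP uP' /abcP vP; exact: hP.
rewrite !E // (sum_sqr_cycle hN hP uP P2 abcP uabc).
by rewrite (sum_sqr_cycle hN hP' uabc _ _ uabc) // -!mulrnA mulnC.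
Qed.

End Bilinear.

End HamiltonianSum.

(** * Counting labellings and orientations *)

Section Counting.
Variable n : nat.

Lemma perm_extension (U V : seq 'I_n) : uniq U -> uniq V -> size U = size V ->
  exists g : {perm 'I_n}, map g U = V.
Proof.
elim: U V => [|u U IH] [|v V] //=; first by exists 1%g.
move=> /andP[uU uqU] /andP[vV uqV] [e].
have [g gU] := IH V uqU uqV e.
exists (g * tperm (g u) v)%g; rewrite permM tpermL; congr (_ :: _).
rewrite -[RHS]gU; apply/eq_in_map => x xU; rewrite permM tpermD //.
  by rewrite (inj_eq perm_inj); apply: contraNneq uU => ->.
by apply: contraNneq vV => ->; rewrite -gU map_f.
Qed.

(** Any two such permutations differ by one that fixes [U] pointwise. *)
Lemma card_perm_map (U V : seq 'I_n) : uniq U -> uniq V -> size U = size V ->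
  #|[set g : {perm 'I_n} | map g U == V]%SET| = (n - size U)`!.
Proof.
move=> uU uV e; have [g0 g0U] := perm_extension uU uV e.
have -> : [set g : {perm 'I_n} | map g U == V]%SET =
    [set (g * g0)%g | g : {perm 'I_n} in perm_on (~: [set x in U])%SET]%SET.
  apply/setP => g; rewrite inE; apply/eqP/imsetP => [gU|[g' g'U ->]].
    exists (g * g0^-1)%g; last by rewrite -mulgA mulVg mulg1.
    rewrite unfold_in; apply/fintype.subsetP => x.
    rewrite !inE permM; apply: contraNN => xU; apply/eqP.
    move: g0U; rewrite -gU => /eq_in_map /(_ x xU) <-.
    by rewrite permK.
  rewrite -g0U; apply/eq_in_map => x xU; rewrite permM (out_perm g'U) //.
  by rewrite !inE negbK.
rewrite card_imset; last exact: mulIg.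
rewrite card_perm; congr (_`!).
rewrite cardsCs finset.setCK card_ord; congr (_ - _)%N.
by rewrite cardsE; apply/card_uniqP.
Qed.

(** The [p] rotations of [r] and the [p] rotations of its reversal are pairwise
    distinct: their first elements distinguish the former among themselves, and
    a rotation of [r] has a different successor function from one of [rev r]. *)
Lemma card_orientations (p : nat) (r : p.-tuple 'I_n) : (2 < p)%N -> uniq r ->
  #|[set t : p.-tuple 'I_n | uniq t & cycle_edges t == cycle_edges r]%SET| = (2 * p)%N.
Proof.
move=> p2 ur.
have p0 : (0 < p)%N by apply: ltn_trans p2.
pose F (b : bool * 'I_p) : p.-tuple 'I_n :=
  if b.1 then [tuple of rot b.2 r] else [tuple of rot b.2 (rev r)].
have -> : [set t : p.-tuple 'I_n | uniq t & cycle_edges t == cycle_edges r]%SET =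
    [set F b | b in [set: bool * 'I_p]]%SET.
  apply/setP => t; rewrite inE; apply/andP/imsetP => [[ut /eqP e]|[[[] i] _ ->] /=].
  - have := @cycle_edges_inj _ r t ur ut; rewrite size_tuple.
    move=> /(_ p2 (esym e)) [i ip [tE|tE]].
      by exists (true, Ordinal ip) => //; apply: val_inj.
    by exists (false, Ordinal ip) => //; apply: val_inj.
  - by rewrite rot_uniq cycle_edges_rot.
  - by rewrite rot_uniq rev_uniq cycle_edges_rot ?rev_uniq // cycle_edges_rev.
rewrite card_imset; first by rewrite cardsT card_prod card_bool card_ord.
pose x0 := tnth r (Ordinal p0).
have rotI (s : p.-tuple 'I_n) (i j : 'I_p) : uniq s -> rot i s = rot j s -> i = j.
  move=> us e; apply: val_inj.
  have nthE (k : 'I_p) : nth x0 (rot k s) 0 = nth x0 s k.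
    by rewrite /rot nth_cat size_drop size_tuple subn_gt0 ltn_ord nth_drop addn0.
  by have := nthE i; rewrite e nthE => /eqP; rewrite nth_uniq ?size_tuple // => /eqP.
have rotF (i j : 'I_p) : rot i r <> rot j (rev r).
  move=> e; have xr : nth x0 r 0 \in r by rewrite mem_nth ?size_tuple.
  have := prev_neq_next ur _ xr; rewrite size_tuple => /(_ p2).
  by rewrite -next_rev // -(next_rot i ur) e next_rot ?rev_uniq // eqxx.
move=> [[] i] [[] j] /(congr1 val) /= e.
- by rewrite (rotI r i j).
- by case: (rotF i j).
- by case: (rotF j i).
- by rewrite (rotI [tuple of rev r] i j) //= rev_uniq.
Qed.

End Counting.

(** * Sums over pairs of disjoint cycles *)

Section GammaSums.
Variables (n : nat).
Let K := @complete_graph n.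

Lemma oriented_cycle_complete (s : seq 'I_n) :
  oriented_cycle K s = (2 < size s)%N && uniq s.
Proof.
rewrite /oriented_cycle /ucycleb; case: ltnP => //= s2.
case us: (uniq s); rewrite ?andbF // andbT.
apply: (sub_in_cycle (P := mem s) _ _ (cycle_next us)); last by apply/allP.
by move=> x y xs _ /= /eqP <-; rewrite /K /complete_graph /= eq_sym next_neq // ltnW.
Qed.

Lemma cyclesP p (c : {set {set 'I_n}}) : (2 < p)%N ->
  reflect (exists2 r : p.-tuple 'I_n, uniq r & c = cycle_edges r)
          (c \in cycles K p).
Proof.
move=> p2; apply: (iffP imsetP) => [[r]|[r ur ->]].
  by rewrite inE oriented_cycle_complete => /andP[_ ur] ->; exists r.
by exists r => //; rewrite inE oriented_cycle_complete size_tuple p2.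
Qed.

Lemma card_cover_cycle p (c : {set {set 'I_n}}) : (2 < p)%N ->
  c \in cycles K p -> #|finset.cover c| = p.
Proof.
move=> p2 /(cyclesP _ p2)[r ur ->]; rewrite cover_cycle_edges //.
by rewrite cardsE (card_uniqP ur) size_tuple.
Qed.

Lemma disjoint_cover_cycles (r s : seq 'I_n) : uniq r -> uniq s ->
  [disjoint finset.cover (cycle_edges r) & finset.cover (cycle_edges s)] =
  uniq (r ++ s).
Proof.
move=> ur us; rewrite !cover_cycle_edges // cat_uniq ur us andbT /=.
rewrite -setI_eq0; apply/eqP/hasPn => [e x xs|h].
  apply/negP => xr; have : x \in ([set x in r] :&: [set x in s])%SET by rewrite !inE xr.
  by rewrite e inE.
by apply/setP => x; rewrite !inE; apply/andP => -[xr /h]; rewrite /= xr.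
Qed.

(** The ordered pairs that [Gamma] makes unordered. *)
Definition disjoint_cycle_pairs p q : {set {set {set 'I_n}} * {set {set 'I_n}}} :=
  [set cd | [&& cd.1 \in cycles K p, cd.2 \in cycles K q
    & [disjoint finset.cover cd.1 & finset.cover cd.2]]]%SET.

Lemma GammaE p q : Gamma K p q =
  [set [set cd.1; cd.2]%SET | cd in disjoint_cycle_pairs p q]%SET.
Proof.
apply/setP => l; apply/imset2P/imsetP => [[c d cp]|[[c d]]].
  by rewrite inE => /andP[dq cd] ->; exists (c, d); rewrite // inE /= cp dq.
rewrite inE /= => /and3P[cp dq cd] ->.
by exists c d; rewrite // inE dq.
Qed.

(** The reversed pair [(d, c)] is again a pair of a [p]-cycle and a [q]-cycle
    exactly when [p = q]; it differs from [(c, d)] by disjointness. *)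
Lemma card_Gamma_fibre p q l : (2 < p)%N -> (2 < q)%N -> l \in Gamma K p q ->
  #|[set cd in disjoint_cycle_pairs p q | [set cd.1; cd.2]%SET == l]%SET| =
  (1 + (p == q))%N.
Proof.
move=> p2 q2; rewrite GammaE => /imsetP[[c d]]; rewrite inE /= => /and3P[cp dq cd] ->.
have cc := card_cover_cycle p2 cp; have cd' := card_cover_cycle q2 dq.
have cNd : c != d.
  apply: contraTneq cd => <-; rewrite -setI_eq0 finset.setIid -cards_eq0 cc.
  by rewrite -lt0n (ltn_trans _ p2).
have E : [set x in disjoint_cycle_pairs p q | [set x.1; x.2]%SET == [set c; d]%SET]%SET =
    ((c, d) |: (if p == q then [set (d, c)]%SET else finset.set0))%SET.
  apply/setP => -[c' d']; rewrite !inE /=; apply/andP/orP.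
    move=> [/and3P[c'p d'q _] /eqP/set2_inj[[-> ->]|[c'd d'c]]]; first by left.
    right; rewrite c'd in c'p; have := card_cover_cycle p2 c'p; rewrite cd' => ->.
    by rewrite eqxx inE c'd d'c.
  case=> [/eqP[-> ->]|]; first by rewrite cp dq cd.
  case: eqP => [pq|_]; rewrite inE // => /eqP[-> ->].
  by rewrite -pq cp pq dq disjoint_sym cd (finset.setUC [set d]%SET).
rewrite E; case: eqP => _; last by rewrite finset.setU0 cards1.
by rewrite cards2 xpair_eqE (negPf cNd).
Qed.

(** [L] stands for the square of the linking number of an unordered pair. *)
Section Sum.
Variables (R : numDomainType) (B : 'I_n -> 'I_n -> 'I_n -> 'I_n -> R).
Variable L : {set {set {set 'I_n}}} -> R.
Hypothesis LE : forall r s, (2 < size r)%N -> (2 < size s)%N -> uniq (r ++ s) ->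
  L [set cycle_edges r; cycle_edges s]%SET = cycle_form B r s ^+ 2.

Definition tuple_sum p q : R :=
  \sum_(rs : p.-tuple 'I_n * q.-tuple 'I_n | uniq (rs.1 ++ rs.2))
    cycle_form B rs.1 rs.2 ^+ 2.

Lemma sum_Gamma_pairs p q : (2 < p)%N -> (2 < q)%N ->
  \sum_(cd in disjoint_cycle_pairs p q) L [set cd.1; cd.2]%SET =
  (\sum_(l in Gamma K p q) L l) *+ (1 + (p == q)).
Proof.
move=> p2 q2.
rewrite (partition_big (fun cd => [set cd.1; cd.2]%SET) (mem (Gamma K p q))) /=;
  last first.
  by move=> cd cdD; rewrite GammaE; apply: imset_f.
rewrite -sumrMnl; apply: eq_bigr => l lG.
rewrite -(card_Gamma_fibre p2 q2 lG) -sumr_const.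
apply: eq_big => [cd|cd /andP[_ /eqP -> //]]; by rewrite inE.
Qed.

Lemma tuple_sum_pairs p q : (2 < p)%N -> (2 < q)%N ->
  tuple_sum p q = (\sum_(cd in disjoint_cycle_pairs p q) L [set cd.1; cd.2]%SET)
    *+ (2 * p * (2 * q)).
Proof.
move=> p2 q2; rewrite /tuple_sum.
rewrite (partition_big
  (fun rs : p.-tuple 'I_n * q.-tuple 'I_n => (cycle_edges rs.1, cycle_edges rs.2))
  (mem (disjoint_cycle_pairs p q))) /=; last first.
  move=> [r s] /= urs; have /and3P[ur _ us] : [&& uniq r, ~~ has [in r] s & uniq s].
    by rewrite -cat_uniq.
  rewrite inE /= disjoint_cover_cycles // urs andbT.
  by apply/andP; split; apply/cyclesP => //; [exists r|exists s].
rewrite -sumrMnl; apply: eq_bigr => -[c d]; rewrite inE /= => /and3P[].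
move=> /(cyclesP _ p2)[r ur cE] /(cyclesP _ q2)[s us dE] cd.
rewrite -(card_orientations p2 ur) -(card_orientations q2 us) -cardsX -sumr_const.
apply: eq_big => [[r' s']|[r' s']] /=.
  rewrite !inE /= xpair_eqE -cE -dE.
  apply/andP/andP => [[urs /andP[/eqP e1 /eqP e2]]|
                      [/andP[ur' /eqP e1] /andP[us' /eqP e2]]].
    by move: urs; rewrite cat_uniq => /and3P[-> _ ->]; rewrite e1 e2 !eqxx.
  by rewrite -disjoint_cover_cycles // e1 e2 cd !eqxx.
by move=> /andP[urs /eqP[<- <-]]; rewrite LE ?size_tuple.
Qed.

Lemma perm_sum_tuple_sum p q (P : p.-tuple 'I_n) (Q : q.-tuple 'I_n) :
  uniq (P ++ Q) -> perm_sum B P Q = tuple_sum p q *+ (n - (p + q))`!.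
Proof.
move=> uPQ; rewrite /perm_sum /tuple_sum.
rewrite (partition_big (fun g : {perm 'I_n} => ([tuple of map g P], [tuple of map g Q]))
  (fun rs : p.-tuple 'I_n * q.-tuple 'I_n => uniq (rs.1 ++ rs.2))) /=; last first.
  by move=> g _; rewrite -map_cat map_inj_uniq //; exact: perm_inj.
rewrite -sumrMnl; apply: eq_bigr => -[r s] /= urs.
have szE : size (P ++ Q) = size (r ++ s) by rewrite !size_cat !size_tuple.
have <- : size (P ++ Q) = (p + q)%N by rewrite size_cat !size_tuple.
rewrite -(card_perm_map uPQ urs szE) -sumr_const.
apply: eq_big => [g|g /eqP[<- <-] //].
by rewrite inE map_cat eqseq_cat ?size_map ?size_tuple // xpair_eqE.
Qed.

Hypothesis BN : forall a b c d, B b a c d = - B a b c d.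
Hypothesis BC : forall a b c d, B c d a b = B a b c d.

Lemma perm_sum_triples (P Q : seq 'I_n) a b c x y z :
  uniq (P ++ Q) -> (2 < size P)%N -> (2 < size Q)%N ->
  {subset [:: a; b; c] <= P} -> uniq [:: a; b; c] ->
  {subset [:: x; y; z] <= Q} -> uniq [:: x; y; z] ->
  perm_sum B P Q *+ 9 = perm_sum B [:: a; b; c] [:: x; y; z] *+ (size P * size Q).
Proof.
move=> uPQ P2 Q2 abcP uabc xyzQ uxyz.
rewrite (mulrnA _ 3 3) (perm_sum_triple BN uPQ P2 abcP uabc) -mulrnAC.
rewrite -(perm_sumC BC) (@perm_sum_triple _ _ _ BN _ _ _ _ _ _ Q2 xyzQ uxyz).
  by rewrite (perm_sumC BC) -mulrnA mulnC.
have /and3P[uQ /hasPn h _] : [&& uniq Q, ~~ has [in Q] P & uniq P].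
  by rewrite -cat_uniq uniq_catC.
rewrite cat_uniq uQ uabc andbT.
by apply/hasPn => t /abcP; exact: h.
Qed.

(** Sums are expressed by [tuple_sum] through [2 p * 2 q] labellings of each pair
    of cycles; [perm_sum_tuple_sum] brings in [0!] permutations for the spanning
    pairs and [(n - 6)!] for the triangles, and [perm_sum_triples] compares the
    two. The common factor [36 p q] is then cancelled. *)
Theorem sum_Gamma_spanning p q : (2 < p)%N -> (2 < q)%N -> n = (p + q)%N ->
  (\sum_(l in Gamma K p q) L l) *+ (1 + (p == q)) =
  (\sum_(l in Gamma K 3 3) L l) *+ (2 * (n - 6)`!).
Proof.
move=> p2 q2 nE.
pose P := take p (enum 'I_n); pose Q := drop p (enum 'I_n).
have sP : size P = p by rewrite size_take size_enum_ord nE; case: ltnP => //; lia.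
have sQ : size Q = q by rewrite size_drop size_enum_ord nE; lia.
have uPQ : uniq (P ++ Q) by rewrite cat_take_drop enum_uniq.
clearbody P Q; move: sP sQ uPQ p2 q2.
case: P => [|a [|b [|c P]]] sP; try by move: sP => /= <-.
case: Q => [|x [|y [|z Q]]] sQ; try by move: sQ => /= <-.
set P' := [:: a, b, c & P] in sP *; set Q' := [:: x, y, z & Q] in sQ *.
move=> uPQ p2 q2.
have uabcxyz : uniq ([tuple a; b; c] ++ [tuple x; y; z]).
  by apply: (subseq_uniq _ uPQ); apply: cat_subseq; rewrite /= !eqxx sub0seq.
have [uabc uxyz] : uniq [:: a; b; c] /\ uniq [:: x; y; z].
  by move: uabcxyz; rewrite cat_uniq => /and3P[].
have abcP : {subset [:: a; b; c] <= P'}.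
  by move=> t; rewrite !inE => /or3P[] ->; rewrite ?orbT.
have xyzQ : {subset [:: x; y; z] <= Q'}.
  by move=> t; rewrite !inE => /or3P[] ->; rewrite ?orbT.
have sP2 : (2 < size P')%N by [].
have := perm_sum_triples uPQ sP2 (isT : 2 < size Q')%N abcP uabc xyzQ uxyz.
rewrite sP sQ (perm_sum_tuple_sum uabcxyz).
have sP' : size P' == p by apply/eqP.
have sQ' : size Q' == q by apply/eqP.
rewrite (@perm_sum_tuple_sum _ _ (Tuple sP') (Tuple sQ')) // -nE subnn.
rewrite !tuple_sum_pairs // !sum_Gamma_pairs // eqxx -!mulrnA => e.
have N0 : (0 < 36 * p * q)%N by rewrite !muln_gt0 !(ltn_trans _ p2) ?(ltn_trans _ q2).
apply: (pmulrnI N0); rewrite -!mulrnA.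
transitivity ((\sum_(l in Gamma K p q) L l) *+
    ((1 + (p == q)) * (2 * p * (2 * q) * (0`! * 9)))).
  by congr (_ *+ _); rewrite fact0; lia.
rewrite e; congr (_ *+ _); rewrite -[(3 + 3)%N]/6%N -[(1 + true)%N]/2%N.
by move: (_`!) => k; lia.
Qed.

End Sum.

End GammaSums.

(** * The edge form of a spatial embedding *)

(* Keeps conversion from unfolding two integrals in order to compare them. *)
Local Opaque gauss_integral.

Section Embedding.
Variables (R : realType) (n : nat) (f : 'rV[R]_n -> 'rV[R]_3).
Let K := @complete_graph n.
Hypothesis emb : spatial_embedding K f.

Lemma edge_point_onem (i j : 'I_n) (t : R) :
  edge_point i j (1 - t) = edge_point j i t.
Proof. by rewrite /edge_point subKr addrC. Qed.

Lemma edge_point_disjoint (x y z w : 'I_n) (s t : R) : uniq [:: x; y; z; w] ->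
  edge_point x y s != edge_point z w t.
Proof.
rewrite /= !inE !negb_or -!andbA => /and5P[xy xz xw yz /andP[yw _]].
apply/eqP => /rowP e; move: (e x) (e y); rewrite !mxE !eqxx /=.
rewrite (eq_sym y x) (negPf xy) (negPf xz) (negPf xw) (negPf yz) (negPf yw) /=.
lra.
Qed.

Lemma edge_curves_disjoint (x y z w : 'I_n) : uniq [:: x; y; z; w] ->
  disjoint_curves (f \o edge_point x y) (f \o edge_point z w).
Proof.
move=> u s t s01 t01; have [finj _] := emb.
have real (i j : 'I_n) r : 0 <= r <= 1 -> i != j ->
    edge_point i j r \in graph_realization K.
  move=> r01 ij; rewrite inE; exists i, j, r; split => //.
  by rewrite /K /complete_graph /= ij orbT.
apply: contraNneq (edge_point_disjoint s t u) => /finj -> //; apply: real => //.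
  by move: u; rewrite /= !inE !negb_or -!andbA => /andP[].
by move: u; rewrite /= !inE !negb_or -!andbA => /and5P[_ _ _ _ /and3P[]].
Qed.

(** Extended by zero to edges with a common vertex, where the images meet, so
    that the symmetries hold for all arguments. *)
Definition edge_form (x y z w : 'I_n) : R :=
  if uniq [:: x; y; z; w] then gauss_integral (f \o edge_point x y) (f \o edge_point z w)
  else 0.

Lemma edge_curve_piecewise_linear (x y : 'I_n) : x != y ->
  piecewise_linear01 (f \o edge_point x y).
Proof. by have [_ +] := emb; apply. Qed.

Lemma uniq4_neq (x y z w : 'I_n) : uniq [:: x; y; z; w] -> x != y /\ z != w.
Proof. by rewrite /= !inE !negb_or -!andbA => /and5P[-> _ _ _ /and3P[_ -> _]]. Qed.

Lemma edge_formC x y z w : edge_form z w x y = edge_form x y z w.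
Proof.
rewrite /edge_form.
have -> : uniq [:: z; w; x; y] = uniq [:: x; y; z; w].
  exact: (uniq_catC [:: z; w] [:: x; y]).
case u: (uniq _); last by [].
have [xy zw] := uniq4_neq u; apply: esym; apply: gauss_integralC.
- exact: edge_curve_piecewise_linear.
- exact: edge_curve_piecewise_linear.
- exact: edge_curves_disjoint.
Qed.

Lemma edge_formN x y z w : edge_form y x z w = - edge_form x y z w.
Proof.
rewrite -edge_formC -[in RHS]edge_formC /edge_form.
have -> : uniq [:: z; w; y; x] = uniq [:: z; w; x; y].
  apply: perm_uniq; rewrite -[[:: z; w; y; x]]/([:: z; w] ++ [:: y; x]).
  rewrite -[[:: z; w; x; y]]/([:: z; w] ++ [:: x; y]) perm_cat2l.
  by rewrite (perm_catC [:: y] [:: x]).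
case u: (uniq _); last by rewrite oppr0.
have [zw xy] := uniq4_neq u.
have pzw := edge_curve_piecewise_linear zw.
have pxy := edge_curve_piecewise_linear xy.
rewrite -(gauss_integral_onem pzw pxy (edge_curves_disjoint u)).
by congr gauss_integral; apply/funext => t /=; rewrite edge_point_onem.
Qed.

Lemma lk_cycle_form (r s : seq 'I_n) : (1 < size r)%N -> (1 < size s)%N ->
  uniq (r ++ s) -> lk f r s = cycle_form edge_form r s.
Proof.
move=> r1 s1; rewrite cat_uniq => /and3P[ur /hasPn rs us].
apply: eq_big_seq => x xr; apply: eq_big_seq => y ys.
have dis u v : u \in r -> v \in s -> u != v.
  by move=> u_r v_s; apply: contraTneq u_r => ->; exact: rs.
rewrite /edge_form ifT //= !inE !negb_or !andbT.
have nx : next r x \in r by rewrite mem_next.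
have ny : next s y \in s by rewrite mem_next.
have xnx : x != next r x by rewrite eq_sym next_neq.
have yny : y != next s y by rewrite eq_sym next_neq.
by rewrite xnx yny !dis.
Qed.

(** The chosen orientation yields the same edge sets, possibly in the other
    order, so the square does not depend on the choice. *)
Lemma lk_sqE (r s : seq 'I_n) : (2 < size r)%N -> (2 < size s)%N -> uniq (r ++ s) ->
  lk_sq K f [set cycle_edges r; cycle_edges s]%SET = cycle_form edge_form r s ^+ 2.
Proof.
move=> r2 s2 urs; have /and3P[ur rs us] : [&& uniq r, ~~ has [in r] s & uniq s].
  by rewrite -cat_uniq.
rewrite /lk_sq.
set l := [set cycle_edges r; cycle_edges s]%SET.
have : link_orientation K l (r, s).
  by split => //=; rewrite oriented_cycle_complete ?r2 ?s2.
case: xgetP => [[r' s'] _ [/= + + /= lE]|no rsl]; last by case: (no (r, s)).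
rewrite !oriented_cycle_complete => /andP[r'2 ur'] /andP[s'2 us'] _.
have urs' : uniq (r' ++ s').
  rewrite -disjoint_cover_cycles //.
  have [[<- <-]|[<- <-]] := set2_inj lE; last rewrite disjoint_sym;
    by rewrite disjoint_cover_cycles.
rewrite (lk_cycle_form (ltnW r'2) (ltnW s'2) urs').
exact: (cycle_form_sqr_edges edge_formN edge_formC ur us ur' us' r2 s2 lE).
Qed.

End Embedding.

(** * The theorem *)

Lemma count_le k n : (k < n)%N -> (\sum_(3 <= p < n) (p <= k) = k - 2)%N.
Proof.
move=> kn; rewrite -big_mkcond /= (eq_bigl (fun p => true && (p < k.+1)%N)) //.
by rewrite -(big_nat_widen _ _ _ predT) // sum_nat_const_nat; lia.
Qed.

(** The two terms count the [p] with [2 p <= n] and with [2 p < n], that is, the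
    unordered decompositions [n = p + q] with weight two if [p < q] and one if
    [p = q]. *)
Lemma count_decompositions n : (6 <= n)%N ->
  (\sum_(3 <= p < n) ((p <= n./2) + (p <= n.-1./2)) = n - 5)%N.
Proof. by move=> n6; rewrite big_split /= !count_le; lia. Qed.

Lemma sum_decompositions (V : nmodType) (n : nat) (F : nat -> nat -> V) :
  \sum_(3 <= p < n) \sum_(p <= q < n | (p + q == n)%N) F p q =
  \sum_(3 <= p < n | (p <= n./2)%N) F p (n - p)%N.
Proof.
rewrite [RHS]big_mkcond; apply: eq_big_nat => p /andP[p3 pn].
rewrite (eq_bigl (fun q => q == n - p)%N) => [|q]; last by apply/eqP/eqP; lia.
by rewrite big_nat1_eq (_ : (p <= n - p < n)%N = (p <= n./2)%N) //; lia.
Qed.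

Theorem theorem1p5 (R : realType) (n : nat) (hn : (6 <= n)%N) :
  (forall p q : nat, (3 <= p)%N -> (3 <= q)%N -> n = (p + q)%N ->
   forall f : 'rV[R]_n -> 'rV[R]_3,
     spatial_embedding (@complete_graph n) f ->
     \sum_(l in Gamma (@complete_graph n) p q) lk_sq (@complete_graph n) f l =
     if p == q then
       (n - 6)`!%:R *
       \sum_(l in Gamma (@complete_graph n) 3 3) lk_sq (@complete_graph n) f l
     else
       2 * (n - 6)`!%:R *
       \sum_(l in Gamma (@complete_graph n) 3 3) lk_sq (@complete_graph n) f l)
  /\
  (forall f : 'rV[R]_n -> 'rV[R]_3,
     spatial_embedding (@complete_graph n) f ->
     \sum_(3 <= p < n) \sum_(p <= q < n | (p + q == n)%N)
       \sum_(l in Gamma (@complete_graph n) p q) lk_sq (@complete_graph n) f l =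
     (n - 5)`!%:R *
     \sum_(l in Gamma (@complete_graph n) 3 3) lk_sq (@complete_graph n) f l).
Proof.
have part1 p q : (3 <= p)%N -> (3 <= q)%N -> n = (p + q)%N ->
   forall f : 'rV[R]_n -> 'rV[R]_3,
     spatial_embedding (@complete_graph n) f ->
     \sum_(l in Gamma (@complete_graph n) p q) lk_sq (@complete_graph n) f l =
     if p == q then
       (n - 6)`!%:R *
       \sum_(l in Gamma (@complete_graph n) 3 3) lk_sq (@complete_graph n) f l
     else
       2 * (n - 6)`!%:R *
       \sum_(l in Gamma (@complete_graph n) 3 3) lk_sq (@complete_graph n) f l.
  move=> p3 q3 nE f emb.
  have := sum_Gamma_spanning (lk_sqE emb) (edge_formN emb) (edge_formC emb) p3 q3 nE.
  move: (\sum_(l in Gamma _ p q) _) (\sum_(l in Gamma _ 3 3) _) => X Y.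
  rewrite -natrM !mulr_natl; case: eqP => _ //.
  by rewrite mulnC mulrnA; exact: pmulrnI.
split=> // f emb; rewrite sum_decompositions.
set Y := \sum_(l in Gamma _ 3 3) _.
rewrite (_ : (n - 5)`! = (n - 5) * (n - 6)`!)%N; last first.
  by rewrite -[(n - 5)%N](_ : (n - 6).+1 = (n - 5)%N) ?factS //; lia.
rewrite -(count_decompositions hn) big_distrl /= natr_sum mulr_suml.
rewrite big_mkcond; apply: eq_big_nat => p /andP[p3 pn].
case: leqP => pn2; last first.
  by rewrite (_ : (p <= n.-1./2)%N = false) ?mul0n ?mul0r //; lia.
rewrite (part1 p (n - p)%N) //; [|lia|lia].
rewrite -/Y natrM natrD.
case: eqP => e.
  by rewrite (_ : (p <= n.-1./2)%N = false) ?addr0 ?mul1r //; lia.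
by rewrite (_ : (p <= n.-1./2)%N = true) //; lia.
Qed.
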